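(* Let $m,M_{\rm b},M_{\rm o}$ be positive integers and let $h_{\rm o},L_{\rm b},L_{\rm o},\sigma_{\rm b},\sigma_{\rm o}>0$. Let $$\mathbf{B}_{\rm o}=\frac{\sigma_{\rm b}^2\nu_{\rm b}L_{\rm b}}{h_{\rm o}}\left(\mathbf{I}_m-L_{\rm b}^2\,\mathbf{\Delta}_{h_{\rm o}}\right)^{-M_{\rm b}},\qquad \mathbf{R}=\frac{\sigma_{\rm o}^2\nu_{\rm o}L_{\rm o}}{h_{\rm o}}\left(\mathbf{I}_m-L_{\rm o}^2\,\mathbf{\Delta}_{h_{\rm o}}\right)^{-M_{\rm o}},\qquad \mathbf{S}_{\rm o}=\mathbf{I}_m+\mathbf{R}^{-1}\mathbf{B}_{\rm o},$$ where $\mathbf{\Delta}_{h_{\rm o}}\in\mathbb{R}^{m\times m}$ is the periodic finite-difference Laplacian matrix. Set $\widetilde{L}_{\rm o}=L_{\rm o}/h_{\rm o}$, $\widetilde{L}_{\rm b/o}=L_{\rm b}/h_{\rm o}$ and $$\alpha=\frac{\sigma_{\rm b}^2\nu_{\rm b}\widetilde{L}_{\rm b/o}}{\sigma_{\rm o}^2\nu_{\rm o}\widetilde{L}_{\rm o}}=\frac{\sigma_{\rm b}^2\nu_{\rm b}L_{\rm b}}{\sigma_{\rm o}^2\nu_{\rm o}L_{\rm o}}.$$ Then $\kappa(\mathbf{S}_{\rm o})\le\eta$, where $$\eta=1+\alpha\left(\frac{\widetilde{L}_{\rm o}^2}{M_{\rm b}}\right)^{M_{\rm b}}\left(\frac{M_{\rm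 o}}{\widetilde{L}_{\rm b/o}^2}\right)^{M_{\rm o}}\left(\frac{M_{\rm b}-M_{\rm o}}{\widetilde{L}_{\rm o}^2-\widetilde{L}_{\rm b/o}^2}\right)^{M_{\rm b}-M_{\rm o}}$$ if the three conditions (i) $\widetilde{L}_{\rm o}^2M_{\rm o}>\widetilde{L}_{\rm b/o}^2M_{\rm b}$, (ii) $M_{\rm o}<M_{\rm b}$, and (iii) $\widetilde{L}_{\rm b/o}^2M_{\rm b}-\widetilde{L}_{\rm o}^2M_{\rm o}>4\widetilde{L}_{\rm b/o}^2\widetilde{L}_{\rm o}^2(M_{\rm o}-M_{\rm b})$ all hold, and $$\eta=1+\alpha\max\left\{\frac{(1+4\widetilde{L}_{\rm o}^2)^{M_{\rm o}}}{(1+4\widetilde{L}_{\rm b/o}^2)^{M_{\rm b}}},\;1\right\}$$ otherwise.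
   Context: $\mathbf{I}_m$ is the $m\times m$ identity matrix. The periodic finite-difference Laplacian matrix $\mathbf{\Delta}_h\in\mathbb{R}^{m\times m}$ acts by $(\mathbf{\Delta}_h u)_p=\frac{1}{h^2}(u_{p+1}-2u_p+u_{p-1})$, $p\in\{0,\dots,m-1\}$, with indices taken modulo $m$ (circulant, with $-2/h^2$ on the diagonal, $1/h^2$ on the first off-diagonals and in the two corners). The constants $\nu_{\rm b}=\nu(M_{\rm b})$ and $\nu_{\rm o}=\nu(M_{\rm o})$ are given by $\nu(M)=\dfrac{2^{2M-1}[(M-1)!]^2}{(2M-2)!}>0$. For a symmetric positive-definite matrix $\mathbf{A}$, $\kappa(\mathbf{A})=\lambda_{\max}(\mathbf{A})/\lambda_{\min}(\mathbf{A})$ is the ratio of its largest and smallest eigenvalues. *)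

(* Defs.v *)
From mathcomp Require Import all_boot all_order all_algebra.
From mathcomp Require Import classical_sets reals.

Set Implicit Arguments.
Unset Strict Implicit.
Unset Printing Implicit Defensive.

Import Order.TTheory GRing.Theory Num.Theory.
Local Open Scope ring_scope.
Local Open Scope classical_set_scope.

(* [ordS] and [ord_pred] are the cyclic successor and predecessor in 'I_m.
   Coinciding positions add up when m <= 2, so that [laplacianE] holds for
   every m. *)
Definition laplacian (R : realType) (m : nat) (h : R) : 'M[R]_m :=
  \matrix_(p, q)
    (h ^- 2 * ((q == ordS p)%:R - 2 * (q == p)%:R + (q == ord_pred p)%:R)).

Lemma laplacianE (R : realType) (m : nat) (h : R) (u : 'cV[R]_m) (p : 'I_m) :
  (laplacian m h *m u) p 0 =
    1 / h ^+ 2 * (u (ordS p) 0 - 2 * u p 0 + u (ord_pred p) 0).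
Proof.
have pick (r : 'I_m) : \sum_q (q == r)%:R * u q 0 = u r 0.
  by rewrite (bigD1 r) //= eqxx mul1r big1 ?addr0 // => q /negPf ->; rewrite mul0r.
rewrite mxE div1r -!pick mulr_sumr -sumrB -big_split mulr_sumr /=.
apply: eq_bigr => q _; rewrite mxE -mulrA; congr (_ * _).
by rewrite mulrDl mulrBl mulrA.
Qed.

Definition nu (R : realType) (M : nat) : R :=
  2 ^+ (2 * M - 1) * ((M - 1)`!)%:R ^+ 2 / ((2 * M - 2)`!)%:R.

Definition covariance (R : realType) (m M : nat) (h L sigma : R) : 'M[R]_m :=
  (sigma ^+ 2 * nu R M * L / h) *:
    invmx ((1%:M - L ^+ 2 *: laplacian m h) ^+ M).

(* For a real symmetric matrix of positive size the set of eigenvalues is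
   finite and nonempty, so that these bounds are attained. *)
Definition lambda_max (R : realType) (m : nat) (A : 'M[R]_m) : R :=
  sup [set a | eigenvalue A a].

Definition lambda_min (R : realType) (m : nat) (A : 'M[R]_m) : R :=
  inf [set a | eigenvalue A a].

Definition kappa (R : realType) (m : nat) (A : 'M[R]_m) : R :=
  lambda_max A / lambda_min A.

(* Main.v *)
Require Import Defs.
From mathcomp Require Import all_boot all_order all_algebra.
From mathcomp Require Import classical_sets reals.
From mathcomp Require Import complex ring lra.

(** Put [K = - ho^2 Delta].  The eigenvalues of [So] are
    [1 + alpha f x], where [f x = (1 + tLo^2 x)^Mo / (1 + tLb^2 x)^Mb] and [x]
    is an eigenvalue of [K]; the quadratic form of [K] is
    [\sum_p (u_p - u_(p+1))^2], so that [x] lies in [0, 4].  Everything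
    reduces to bounding [f] on [0, 4], at 0, at 4, or at the critical point
    of [f].  Each comparison [f x <= f y] is an instance of the weighted AM-GM
    inequality [u^k <= (1 + k (u - 1) / n)^n] for [k <= n], with
    [u = (1 + c x) / (1 + c y)]. *)

Set Implicit Arguments.
Unset Strict Implicit.
Unset Printing Implicit Defensive.

Import Order.TTheory GRing.Theory Num.Theory.
Local Open Scope ring_scope.

(** * Spectrum of the periodic Laplacian *)

(** The matrix [K], free of the mesh size. The coefficient ring is arbitrary so that [K] can be
    transported from [R] to [R[i]]. *)
Definition cycle_mx (F : pzRingType) (m : nat) : 'M[F]_m :=
  \matrix_(p, q) (2 * (q == p)%:R - (q == ordS p)%:R - (q == ord_pred p)%:R).

Lemma map_cycle_mx (F G : pzRingType) (f : {rmorphism F -> G}) m :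
  map_mx f (cycle_mx F m) = cycle_mx G m.
Proof. by apply/matrixP=> p q; rewrite !mxE !rmorphB rmorphM !rmorph_nat. Qed.

Lemma laplacian_cycle (R : realType) m (h : R) :
  laplacian m h = - h ^- 2 *: cycle_mx R m.
Proof. by apply/matrixP=> p q; rewrite !mxE; ring. Qed.

Lemma mul_cycle_mx (F : pzRingType) m (v : 'rV[F]_m) q :
  (v *m cycle_mx F m) 0 q = v 0 q *+ 2 - v 0 (ord_pred q) - v 0 (ordS q).
Proof.
have pick (r : 'I_m) (f : 'I_m -> 'I_m) :
    (forall p, (q == f p) = (p == r)) -> \sum_p v 0 p * (q == f p)%:R = v 0 r.
  move=> fE; rewrite (bigD1 r) //= fE eqxx mulr1 big1 ?addr0 // => p /negPf pr.
  by rewrite fE pr mulr0.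
rewrite mxE -(pick q id) => [|p]; last exact: eq_sym.
rewrite -(pick (ord_pred q) (@ordS m)); last first.
  by move=> p; rewrite eq_sym (can2_eq (@ordSK m) (@ord_predK m)).
rewrite -(pick (ordS q) (@ord_pred m)); last first.
  by move=> p; rewrite eq_sym (can2_eq (@ord_predK m) (@ordSK m)).
rewrite mulr2n -big_split /= -!sumrB; apply: eq_bigr => p _; rewrite mxE.
by rewrite !mulrBr mulr_natl mulr2n mulrDr.
Qed.

(** Pairing [v K = x v] with the conjugate of [v] makes both [x |v|^2] and [(4 - x) |v|^2] sums of
    squared moduli, of [v_q - v_(q+1)] and of [v_q + v_(q+1)]. *)
Lemma eigenvalue_cycle (C : numClosedFieldType) m (x : C) :
  eigenvalue (cycle_mx C m) x -> 0 <= x <= 4.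
Proof.
case/eigenvalueP=> v vK v_neq0.
pose e := \sum_q `|v 0 q| ^+ 2.
have e_gt0 : 0 < e.
  rewrite lt_def sumr_ge0 ?andbT => [|q _]; last exact: exprn_ge0.
  apply: contraNneq v_neq0 => /eqP; rewrite psumr_eq0 => [/allP v0|q _].
    apply/eqP/rowP=> q; rewrite mxE; apply/eqP.
    by have:= v0 q (mem_index_enum q); rewrite expf_eq0 normr_eq0.
  exact: exprn_ge0.
have shift (F : 'I_m -> C) : \sum_q F (ordS q) = \sum_q F q.
  by rewrite [RHS](reindex_inj (@ordS_inj m)).
(* Twice the real part of the correlation of [v] with its shift: the two sums of squares expand to
   [2 * e - c] and [2 * e + c]. *)
pose c := \sum_q (v 0 q * (v 0 (ordS q))^* + v 0 (ordS q) * (v 0 q)^*).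
have eS : \sum_q `|v 0 (ordS q)| ^+ 2 = e.
  exact: (shift (fun q => `|v 0 q| ^+ 2)).
have xe : x * e = 2 * e - c.
  have -> : x * e = \sum_q (v *m cycle_mx C m) 0 q * (v 0 q)^*.
    by rewrite mulr_sumr; apply: eq_bigr => q _; rewrite vK mxE normCK mulrA.
  have -> : c = \sum_q (v 0 (ord_pred q) * (v 0 q)^* + v 0 (ordS q) * (v 0 q)^*).
    rewrite /c !big_split; congr (_ + _).
    rewrite -[RHS](shift (fun q => v 0 (ord_pred q) * (v 0 q)^*)).
    by apply: eq_bigr => q _; rewrite ordSK.
  rewrite mulr_sumr -sumrB; apply: eq_bigr => q _.
  by rewrite mul_cycle_mx normCK; ring.
have lo : x * e = \sum_q `|v 0 q - v 0 (ordS q)| ^+ 2.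
  rewrite xe mulr_natl mulr2n -{2}eS -big_split -sumrB; apply: eq_bigr => q _.
  by rewrite /= !normCK rmorphB; ring.
have hi : (4 - x) * e = \sum_q `|v 0 q + v 0 (ordS q)| ^+ 2.
  have -> : (4 - x) * e = e + e + c by rewrite mulrBl xe; ring.
  rewrite -{2}eS -!big_split; apply: eq_bigr => q _.
  by rewrite /= !normCK rmorphD; ring.
rewrite -(pmulr_lge0 _ e_gt0) lo -(subr_ge0 x) -(pmulr_lge0 (4 - x) e_gt0) hi.
by rewrite !sumr_ge0 // => q _; apply: exprn_ge0.
Qed.

(** Since [p] splits, [p(A)] is a scalar times a product of factors [A - x], and one of these must
    be singular. *)
Lemma singular_horner_eigenvalue (F : closedFieldType) n (A : 'M[F]_n.+1)
    (p : {poly F}) :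
  p != 0 -> \det (horner_mx A p) = 0 -> exists2 x, eigenvalue A x & root p x.
Proof.
have [r ->] := closed_field_poly_normal p.
rewrite scaler_eq0 negb_or lead_coef_eq0 => /andP[p0 _].
rewrite linearZ /= detZ => /eqP.
rewrite mulf_eq0 expf_eq0 /= lead_coef_eq0 (negPf p0) rmorph_prod /=.
rewrite (big_morph _ (@det_mulmx _ _) (det1 _ _)) prodf_seq_eq0.
case/hasP=> x xr /det0P[v v0 vA]; exists x.
  apply/eigenvalueP; exists v => //; move: vA.
  rewrite rmorphB /= horner_mx_X horner_mx_C mulmxBr mul_mx_scalar.
  by move/eqP; rewrite subr_eq0 => /eqP.
by rewrite rootZ ?lead_coef_eq0 // root_prod_XsubC.
Qed.

(** This stands in for diagonalizing [K]. The root is found in [R[i]]; being an eigenvalue of [K] it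
    is nonnegative, hence real. *)
Lemma singular_horner_cycle (R : realType) n (p : {poly R}) :
  \det (horner_mx (cycle_mx R n.+1) p) = 0 -> exists2 x, 0 <= x <= 4 & root p x.
Proof.
have [-> _|p0 /(congr1 (real_complex R))] := eqVneq p 0.
  by exists 0; rewrite ?root0 // lexx ler0n.
rewrite rmorph0 -det_map_mx map_horner_mx map_cycle_mx.
case/singular_horner_eigenvalue; first by rewrite map_poly_eq0.
move=> z /eigenvalue_cycle /andP[z0 z4].
have /complex_realP[x zx] := ger0_real z0; rewrite zx fmorph_root => px.
exists x => //; rewrite -(lecR 0 x) -(lecR x 4) -zx z0.
by move: z4; rewrite (rmorph_nat (real_complex R) 4).
Qed.

(** * Bounds on the scalar function [f] *)

(** AM-GM for [k] copies of [u] and [n - k] copies of 1. *)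
Lemma expr_le_tangent (R : realFieldType) k n (u : R) :
  (0 < n)%N -> (k <= n)%N -> 0 <= u ->
  u ^+ k <= (1 + k%:R * (u - 1) / n%:R) ^+ n.
Proof.
move=> n_gt0 le_kn u_ge0.
have n_neq0 : n%:R != 0 :> R by rewrite pnatr_eq0 -lt0n.
pose E (i : 'I_n) := if (i < k)%N then u else 1.
have E_ge0 : {in predT, forall i, 0 <= E i} by move=> i _; rewrite /E; case: ifP.
have prodE : \prod_i E i = u ^+ k.
  rewrite /E -big_mkcond -(big_ord_widen n (fun=> u)) //.
  by rewrite prodr_const card_ord.
have sumE : \sum_i E i = n%:R + k%:R * (u - 1).
  transitivity (\sum_(i < n) (1 + (if (i < k)%N then u - 1 else 0))).
    by apply: eq_bigr => i _; rewrite /E; case: ifP; rewrite ?subrKC ?addr0.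
  rewrite big_split /= -big_mkcond -(big_ord_widen n (fun=> u - 1)) //.
  by rewrite !sumr_const !card_ord mulr_natl.
have [] := leif_AGM E_ge0.
by rewrite prodE sumE card_ord mulrDl divff.
Qed.

Lemma affine_gt0 (R : realFieldType) (c x : R) :
  0 <= c -> 0 <= x -> 0 < 1 + c * x.
Proof. by move=> c0 x0; rewrite ltr_wpDr ?mulr_ge0. Qed.

Definition spectral_ratio (R : realFieldType) k n (c d x : R) :=
  (1 + c * x) ^+ k / (1 + d * x) ^+ n.

(** The last hypothesis says [(x - y) * f'(y) <= 0], cleared of denominators. The claim is
    [u ^+ k <= w ^+ n]; AM-GM bounds the left side by the [n]-th power of an affine function of [u],
    and the hypothesis puts that function below [w]. *)
Lemma ratio_le_tangent (R : realFieldType) k n (c d x y : R) :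
  (0 < n)%N -> (k <= n)%N -> 0 <= c -> 0 <= d -> 0 <= x -> 0 <= y ->
  (x - y) * (k%:R * c * (1 + d * y)) <= (x - y) * (n%:R * d * (1 + c * y)) ->
  spectral_ratio k n c d x <= spectral_ratio k n c d y.
Proof.
rewrite /spectral_ratio => n_gt0 le_kn c0 d0 x0 y0 slope.
have [cx cy] := (affine_gt0 c0 x0, affine_gt0 c0 y0).
have [dx dy] := (affine_gt0 d0 x0, affine_gt0 d0 y0).
have n0 : 0 < n%:R :> R by rewrite ltr0n.
set u := (1 + c * x) / (1 + c * y); set w := (1 + d * x) / (1 + d * y).
have u0 : 0 <= u by rewrite divr_ge0 ?ltW.
suff uw : u ^+ k <= w ^+ n.
  rewrite ler_pdivrMr ?exprn_gt0 // mulrAC ler_pdivlMr ?exprn_gt0 //.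
  move: uw; rewrite !expr_div_n ler_pdivrMr ?exprn_gt0 // mulrAC.
  by rewrite ler_pdivlMr ?exprn_gt0 // [X in _ <= X]mulrC.
apply: le_trans (expr_le_tangent n_gt0 le_kn u0) _.
have le_k : k%:R <= n%:R :> R by rewrite ler_nat.
apply: lerXn2r.
- rewrite nnegrE.
  have -> : 1 + k%:R * (u - 1) / n%:R = (n%:R - k%:R + k%:R * u) / n%:R.
    by field; rewrite gt_eqF.
  by apply/divr_ge0/ler0n/addr_ge0; [rewrite subr_ge0 | apply: mulr_ge0].
- by rewrite nnegrE divr_ge0 ?ltW.
have -> : u - 1 = c * (x - y) / (1 + c * y) by rewrite /u; field; rewrite gt_eqF.
have -> : w = 1 + d * (x - y) / (1 + d * y) by rewrite /w; field; rewrite gt_eqF.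
rewrite lerD2l -subr_ge0.
have -> : d * (x - y) / (1 + d * y) - k%:R * (c * (x - y) / (1 + c * y)) / n%:R =
    ((x - y) * (n%:R * d * (1 + c * y)) - (x - y) * (k%:R * c * (1 + d * y)))
      / (n%:R * (1 + c * y) * (1 + d * y)).
  by field; rewrite !gt_eqF.
by rewrite divr_ge0 ?subr_ge0 // !mulr_ge0 ?ltW.
Qed.

Lemma spectral_ratio_endpoints (R : realFieldType) k n (c d t x : R) :
  (0 < k)%N -> (0 < n)%N -> 0 <= c -> 0 <= d -> 0 <= x <= t ->
  ~~ [&& d * n%:R < c * k%:R, (k < n)%N &
         t * d * c * (k%:R - n%:R) < d * n%:R - c * k%:R] ->
  spectral_ratio k n c d x <= Num.max (spectral_ratio k n c d t) 1.
Proof.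
move=> k0 n0 c0 d0 /andP[x0 xt] cond.
have at0 : spectral_ratio k n c d 0 = 1.
  by rewrite /spectral_ratio !mulr0 addr0 !expr1n divr1.
have t0 : 0 <= t by apply: le_trans xt.
rewrite le_max -at0.
have [lt_kn|le_nk] := ltnP k n; last first.
  (* Here f is quasi-convex: AM-GM applies to 1 / f, exchanging k and n. *)
  have flip y : 0 <= y ->
      (y - x) * (n%:R * d * (1 + c * x)) <= (y - x) * (k%:R * c * (1 + d * x)) ->
      spectral_ratio k n c d x <= spectral_ratio k n c d y.
    move=> y0 /(ratio_le_tangent k0 le_nk d0 c0 y0 x0).
    rewrite /spectral_ratio -[X in X <= _ -> _]invf_div -[X in _ <= X -> _]invf_div.
    by rewrite lef_pV2 // posrE divr_gt0 ?exprn_gt0 ?affine_gt0.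
  (* The sign of [f'(x)] selects the endpoint: [t] if it is nonnegative, 0 otherwise. *)
  have [D|/ltW D] := leP (n%:R * d * (1 + c * x)) (k%:R * c * (1 + d * x)).
    by rewrite flip // ler_wpM2l // subr_ge0.
  by rewrite orbC flip // sub0r !mulNr lerN2 ler_wpM2l.
(* For [k < n], failure of the first inequality means [f'(0) <= 0], so 0 is a maximum; failure of
   the third means [f'(t) >= 0], so [t] is one. *)
move: cond; rewrite lt_kn /= negb_and -!leNgt => /orP[ge0|geT].
  rewrite orbC ratio_le_tangent ?(ltnW lt_kn) //.
  by rewrite subr0 ler_wpM2l // !mulr0 addr0 !mulr1 ![_%:R * _]mulrC.
rewrite ratio_le_tangent ?(ltnW lt_kn) // ler_wnM2l ?subr_le0 //.
lra.
Qed.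

Lemma spectral_ratio_critical (R : realFieldType) k n (c d x : R) :
  (0 < k)%N -> (k < n)%N -> 0 < c -> 0 < d -> 0 <= x ->
  d * n%:R < c * k%:R ->
  spectral_ratio k n c d x <=
    (c / n%:R) ^+ n * (k%:R / d) ^+ k * ((n%:R - k%:R) / (c - d)) ^+ (n - k).
Proof.
move=> k0 lt_kn c0 d0 x0 cond.
have n0 : (0 < n)%N by apply: leq_trans lt_kn.
have [kR nR] : 0 < k%:R :> R /\ 0 < n%:R :> R by rewrite !ltr0n.
have nk : 0 < n%:R - k%:R :> R by rewrite subr_gt0 ltr_nat.
(* From [d * n < c * k < c * n]. *)
have cd : 0 < c - d by nra.
have dE : (d != 0) * (c != 0) * (n%:R - k%:R != 0 :> R) * (c - d != 0)
  * (k%:R != 0 :> R) * (n%:R != 0 :> R) by rewrite !gt_eqF.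
(* The zero of [f'], that is, the solution of [k c (1 + d y) = n d (1 + c y)]. The slope hypothesis
   is then an equality on either side of [y]. *)
pose y := (k%:R * c - n%:R * d) / (c * d * (n%:R - k%:R)).
have cyE : 1 + c * y = k%:R * (c - d) / (d * (n%:R - k%:R)).
  by rewrite /y; field; rewrite !dE.
have dyE : 1 + d * y = n%:R * (c - d) / (c * (n%:R - k%:R)).
  by rewrite /y; field; rewrite !dE.
have y0 : 0 <= y.
  by rewrite divr_ge0 ?mulr_ge0 ?ltW // subr_gt0 ![_%:R * _]mulrC.
apply: (@le_trans _ _ (spectral_ratio k n c d y)).
  apply: ratio_le_tangent (ltW c0) (ltW d0) x0 y0 _ => //; first exact: ltnW.
  by rewrite le_eqVlt cyE dyE; apply/orP; left; apply/eqP; field; rewrite !dE.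
rewrite le_eqVlt; apply/orP; left; apply/eqP.
rewrite /spectral_ratio cyE dyE expfB //.
rewrite !(exprMn, exprVn, invfM, invrK).
field; rewrite !expf_neq0 ?dE //.
Qed.

(** * From the matrices to the scalar bounds *)

Lemma covariance_cycle (R : realType) m M (h L sigma : R) :
  h != 0 ->
  covariance m M h L sigma = (sigma ^+ 2 * nu R M * L / h) *:
    invmx ((1%:M + (L / h) ^+ 2 *: cycle_mx R m) ^+ M).
Proof.
move=> h0; rewrite /covariance laplacian_cycle scalerA mulrN scaleNr opprK.
by rewrite expr_div_n.
Qed.

Lemma nu_gt0 (R : realType) M : 0 < nu R M.
Proof. by rewrite divr_gt0 ?mulr_gt0 ?exprn_gt0 // ltr0n fact_gt0. Qed.

Lemma horner_affine_expr (R : comNzRingType) n (B : 'M[R]_n.+1) (c : R) M :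
  horner_mx B ((1 + c *: 'X) ^+ M) = (1%:M + c *: B) ^+ M.
Proof. by rewrite rmorphXn rmorphD /= rmorph1 linearZ /= horner_mx_X. Qed.

(** A zero determinant would give [(1 + c X)^M] a root in [0, 4], where it is positive. *)
Lemma affine_cycle_expr_unit (R : realType) n (c : R) M :
  0 <= c -> (1%:M + c *: cycle_mx R n.+1) ^+ M \in unitmx.
Proof.
move=> c0; rewrite unitmxE unitfE -horner_affine_expr; apply/eqP.
case/singular_horner_cycle => x /andP[x0 _].
by rewrite /root !hornerE => /eqP; apply/eqP; rewrite expf_neq0 // gt_eqF ?affine_gt0.
Qed.

Lemma kappa_le (R : realType) m (A : 'M[R]_m) (b : R) :
  1 <= b -> (forall a, eigenvalue A a -> 1 <= a <= b) -> kappa A <= b.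
Proof.
move=> b1 spec; have b0 : 0 <= b by apply: le_trans b1.
rewrite /kappa /lambda_max /lambda_min; set S := [set a | _]%classic.
(* On an empty set [sup] takes the default value 0, which makes the quotient 0. *)
have [->|S0] := eqVneq S set0; first by rewrite sup0 mul0r.
have lo : 1 <= inf S by apply: lb_le_inf; [exact/set0P|move=> a /spec /andP[]].
rewrite ler_pdivrMr ?(lt_le_trans ltr01) //.
apply: le_trans (ler_peMr b0 lo).
by apply: ge_sup; [exact/set0P|move=> a /spec /andP[]].
Qed.

(** Clearing the inverse turns the eigenvector equation for [a] into [v p(K) = 0] for a polynomial
    [p]; a root of [p] in [0, 4] is the required [x]. *)
Lemma eigenvalue_ratio (R : realType) n k l (c d r a : R) :
  0 <= c -> 0 <= d ->
  let A e := 1%:M + e *: cycle_mx R n.+1 in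
  eigenvalue (1%:M + r *: (A c ^+ k *m invmx (A d ^+ l))) a ->
  exists2 x, 0 <= x <= 4 & a = 1 + r * spectral_ratio k l c d x.
Proof.
move=> c0 d0 A /eigenvalueP[v vS v0].
pose p := r *: (1 + c *: 'X) ^+ k - (a - 1) *: (1 + d *: 'X) ^+ l.
have [|x x04 px] := @singular_horner_cycle R n p.
  apply/eqP/det0P; exists v => //.
  rewrite rmorphB /= !linearZ /= !horner_affine_expr scalerN mulmxBr -!scalemxAr.
  have vE : r *: (v *m (A c ^+ k *m invmx (A d ^+ l))) = (a - 1) *: v.
    rewrite scalemxAr scalerBl scale1r -vS mulmxDr mulmx1.
    by rewrite addrC addKr.
  have -> : A c ^+ k = A c ^+ k *m invmx (A d ^+ l) *m A d ^+ l.
    by rewrite mulmxKV ?affine_cycle_expr_unit.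
  by rewrite mulmxA scalemxAl vE -scalemxAl subrr.
exists x => //.
have dx : 0 < 1 + d * x by case/andP: x04 => x0 _; apply: affine_gt0.
have {}px : r * (1 + c * x) ^+ k = (a - 1) * (1 + d * x) ^+ l.
  by apply/eqP; rewrite -subr_eq0; move: px; rewrite /root /p !hornerE.
by rewrite /spectral_ratio mulrA px mulfK ?expf_neq0 ?gt_eqF // subrKC.
Qed.

Theorem theorem5 (R : realType) (m Mb Mo : nat) (ho Lb Lo sigmab sigmao : R)
    (m_gt0 : (0 < m)%N) (Mb_gt0 : (0 < Mb)%N) (Mo_gt0 : (0 < Mo)%N)
    (ho_gt0 : 0 < ho) (Lb_gt0 : 0 < Lb) (Lo_gt0 : 0 < Lo)
    (sigmab_gt0 : 0 < sigmab) (sigmao_gt0 : 0 < sigmao) :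
  let Bo : 'M[R]_m := covariance m Mb ho Lb sigmab in
  let Rm : 'M[R]_m := covariance m Mo ho Lo sigmao in
  let So : 'M[R]_m := 1%:M + invmx Rm *m Bo in
  let tLo := Lo / ho in
  let tLb := Lb / ho in
  let alpha :=
    (sigmab ^+ 2 * nu R Mb * tLb) / (sigmao ^+ 2 * nu R Mo * tLo) in
  let eta :=
    if [&& tLb ^+ 2 * Mb%:R < tLo ^+ 2 * Mo%:R,
           (Mo < Mb)%N &
           4 * tLb ^+ 2 * tLo ^+ 2 * (Mo%:R - Mb%:R)
             < tLb ^+ 2 * Mb%:R - tLo ^+ 2 * Mo%:R]
    then 1 + alpha * (tLo ^+ 2 / Mb%:R) ^+ Mb * (Mo%:R / tLb ^+ 2) ^+ Mo
             * ((Mb%:R - Mo%:R) / (tLo ^+ 2 - tLb ^+ 2)) ^+ (Mb - Mo)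
    else 1 + alpha * Num.max ((1 + 4 * tLo ^+ 2) ^+ Mo
                                / (1 + 4 * tLb ^+ 2) ^+ Mb) 1 in
  kappa So <= eta.
Proof.
case: m m_gt0 => // n _; cbv zeta.
set So := 1%:M + _ *m _; set tLo := Lo / ho; set tLb := Lb / ho.
set alpha := _ / (sigmao ^+ 2 * _ * _); set eta := if _ then _ else _.
have tLo_gt0 : 0 < tLo by apply: divr_gt0.
have tLb_gt0 : 0 < tLb by apply: divr_gt0.
have c0 : 0 < tLo ^+ 2 by apply: exprn_gt0.
have d0 : 0 < tLb ^+ 2 by apply: exprn_gt0.
have alpha_gt0 : 0 < alpha by rewrite divr_gt0 // mulr_gt0 // mulr_gt0 ?exprn_gt0 ?nu_gt0.
(* Inverting [Rm] undoes its inner inverse, and the quotient of the two scalar prefactors is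
   [alpha]. *)
have SoE : So = 1%:M + alpha *: ((1%:M + tLo ^+ 2 *: cycle_mx R n.+1) ^+ Mo *m
    invmx ((1%:M + tLb ^+ 2 *: cycle_mx R n.+1) ^+ Mb)).
  have cR : sigmao ^+ 2 * nu R Mo * Lo / ho != 0.
    by rewrite gt_eqF // divr_gt0 // mulr_gt0 // mulr_gt0 ?exprn_gt0 ?nu_gt0.
  have uo := affine_cycle_expr_unit n Mo (ltW c0).
  rewrite /So !covariance_cycle ?gt_eqF // invmxZ; last first.
    by rewrite unitmxZ ?unitfE // unitmx_inv.
  rewrite invmxK -scalemxAl -scalemxAr scalerA; congr (_ + _ *: _).
  rewrite /alpha /tLo /tLb; field.
  by rewrite !gt_eqF ?nu_gt0.
have bound x : 0 <= x <= 4 ->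
    1 + alpha * spectral_ratio Mo Mb (tLo ^+ 2) (tLb ^+ 2) x <= eta.
  move=> x04; rewrite /eta; case: ifPn => [/and3P[cond lt_Mob _]|cond].
    have x0 : 0 <= x by case/andP: x04.
    have := spectral_ratio_critical Mo_gt0 lt_Mob c0 d0 x0 cond.
    by rewrite -(ler_pM2l alpha_gt0) lerD2l [leRHS]mulrA [X in _ <= X * _]mulrA.
  rewrite lerD2l ler_pM2l //.
  have := spectral_ratio_endpoints Mo_gt0 Mb_gt0 (ltW c0) (ltW d0) x04 cond.
  by rewrite /spectral_ratio ![_ * 4]mulrC.
have ratio_ge0 x : 0 <= x ->
    0 <= alpha * spectral_ratio Mo Mb (tLo ^+ 2) (tLb ^+ 2) x.
  move=> x0; apply: mulr_ge0; first exact: ltW.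
  by rewrite divr_ge0 // exprn_ge0 // addr_ge0 // mulr_ge0 // ltW.
apply: kappa_le => [|a].
  (* [1 <= eta] comes from the bound at [x = 0], as the added term is nonnegative. *)
  have := bound 0; rewrite lexx ler0n => /(_ isT); apply: le_trans.
  by rewrite lerDl ratio_ge0.
rewrite SoE => /(eigenvalue_ratio (ltW c0) (ltW d0))[x x04 ->].
by rewrite bound // lerDl ratio_ge0 //; case/andP: x04.
Qed.
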